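(* For every positive integer $k$ there exists $n$ such that the shift graph $H_n$ does not admit two $k$-orthogonal tree decompositions.
   Context: The shift graph $H_n$ has vertex set $\{(i,j):1\le i<j\le n\}$ and edge set $\{(i,j)(j,\ell):1\le i<j<\ell\le n\}$. A tree decomposition of a graph $G$ is a tree with bags $T_x\subseteq V(G)$ such that every edge has both ends in some bag and for every vertex the nodes whose bags contain it induce a non-empty connected subtree. Two tree decompositions $S$ and $T$ of $G$ are $k$-orthogonal if $|S_x\cap T_y|\le k$ for all nodes $x$ of $S$ and $y$ of $T$. *)

(* Defs.v *)
From mathcomp Require Import all_boot.

Set Implicit Arguments.
Unset Strict Implicit.
Unset Printing Implicit Defensive.

Record sgraph := SGraph {
  vert :> finType;
  adj : rel vert;
  adj_sym : symmetric adj;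
  adj_irrefl : irreflexive adj
}.

Section Induced.
Variables (G : sgraph) (A : {set G}).

Definition induced_adj : rel {x : G | x \in A} :=
  fun x y => adj (val x) (val y).

Lemma induced_adj_sym : symmetric induced_adj.
Proof. by move=> x y; apply: adj_sym. Qed.

Lemma induced_adj_irrefl : irreflexive induced_adj.
Proof. by move=> x; apply: adj_irrefl. Qed.

Definition induced : sgraph := SGraph induced_adj_sym induced_adj_irrefl.
End Induced.

Definition connected (G : sgraph) : Prop :=
  forall x y : G, connect (@adj G) x y.

(* By symmetry, every edge x y yields the closed walk [:: x; y], so only
   duplicate-free closed walks on at least 3 vertices are graph cycles. *)
Definition acyclic (G : sgraph) : Prop :=
  forall c : seq G, ucycle (@adj G) c -> size c <= 2.

Definition is_tree (G : sgraph) : Prop :=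
  [/\ 0 < #|G|, connected G & acyclic G].

Record tree_decomp (G : sgraph) := TreeDecomp {
  td_tree : sgraph;
  td_bag : td_tree -> {set G};
  td_treeP : is_tree td_tree;
  td_edge : forall u v : G, adj u v ->
    exists x, (u \in td_bag x) && (v \in td_bag x);
  td_vertex : forall v : G, is_tree (induced [set x | v \in td_bag x])
}.

Definition orthogonal (G : sgraph) (k : nat) (S T : tree_decomp G) : Prop :=
  forall (x : td_tree S) (y : td_tree T), #|td_bag x :&: td_bag y| <= k.

Section ShiftGraph.
Variable n : nat.

(* Pairs range over {0, ..., n-1} instead of {1, ..., n}. *)
Definition shift_vertex : finType := {p : 'I_n * 'I_n | p.1 < p.2}.

(* An edge (i,j)(j,l) is unordered; i < j < l is enforced by shift_vertex. *)
Definition shift_adj : rel shift_vertex := fun u v =>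
  ((val u).2 == (val v).1) || ((val v).2 == (val u).1).

Lemma shift_adj_sym : symmetric shift_adj.
Proof. by move=> u v; rewrite /shift_adj orbC. Qed.

Lemma shift_adj_irrefl : irreflexive shift_adj.
Proof.
move=> u; rewrite /shift_adj orbb; apply/negbTE/eqP => e.
by have := valP u; rewrite e ltnn.
Qed.

Definition shift_graph : sgraph := SGraph shift_adj_sym shift_adj_irrefl.
End ShiftGraph.

(* Main.v *)
(** Two vertices meet in a tree decomposition if they share a bag.  The meeting
    graph is chordal, so each of its 4-cycles has a chord, and by the Helly
    property a clique for both decompositions lies in the intersection of
    two bags.  By Ramsey's theorem for triples we may assume that, for each
    decomposition, whether [(i,j),(i,l)] meet (L) and whether [(i,l),(j,l)]
    meet (R) does not depend on [i < j < l].  Chords of 4-cycles of the shift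
    graph give L or R for each decomposition.  If both have L, or both have R,
    a star is a clique for both.  Otherwise each has exactly one of L and R, and
    further 4-cycles force disjoint pairs [i < j < l < q] to meet, so
    [(0,1), (2,3), (4,5), ...] is a clique for both. *)
Require Import Defs.
From mathcomp Require Import all_boot zify.

Set Implicit Arguments.
Unset Strict Implicit.
Unset Printing Implicit Defensive.

(** * Ramsey's theorem for subsequences *)

Lemma subseq_map_inv (T1 T2 : eqType) (f : T1 -> T2) (u : seq T2) (t : seq T1) :
  subseq u (map f t) -> exists2 v, subseq v t & u = map f v.
Proof.
case/subseqP=> b _ ->; exists (mask b t); first exact: mask_subseq.
by rewrite map_mask.
Qed.

Lemma pigeonhole_seq (C : finType) (m : nat) (s : seq C) :
  0 < size s -> #|C| * m <= size s -> exists c, m <= count_mem c s.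
Proof.
case: m => [|m]; first by case: s => // c s _ _; exists c.
move=> s_gt0 le_s; apply/existsP; apply: contraLR le_s.
rewrite negb_exists -ltnNge => /forallP lt_m.
have -> : size s = \sum_(c : C) count_mem c s.
  elim: s {s_gt0 lt_m} => [|a s IHs]; first by rewrite big1.
  rewrite /= big_split /= -IHs (bigD1 a) //= eqxx big1 // => c.
  by rewrite eq_sym => /negbTE ->.
case: s s_gt0 lt_m => // a s _ lt_m.
rewrite -sum_nat_const (bigD1 a) //= [X in _ < X](bigD1 a) //= -addSn.
rewrite leq_add //; first by rewrite ltnNge lt_m.
by apply: leq_sum => c _; rewrite ltnW // ltnNge lt_m.
Qed.

(** Induction on [r]: first extract a sequence in which the colour of an [r.+1]-subsequence depends
    only on its first entry, then keep the entries that carry a most convenient common colour. *)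
Lemma ramsey (C : finType) (r m : nat) :
  exists N, forall (T : eqType) (f : seq T -> C) (s : seq T), N <= size s ->
    exists t c, [/\ subseq t s, m <= size t &
      forall u, subseq u t -> size u = r -> f u = c].
Proof.
elim: r m => [|r IHr] m.
  exists m => T f s le_s; exists s, (f [::]); split=> // u _.
  by move/size0nil->.
(* An entry [(x, c)] of [t] records the colour [c] of all [r.+1]-subsequences that start at [x]. The
   successor in the length keeps the list of colours non-empty for the pigeonhole. *)
have [N HN] : exists N, forall (T : eqType) (f : seq T -> C) (s : seq T),
    N <= size s -> exists t : seq (T * C), [/\ subseq (map fst t) s,
      (#|C| * m).+1 <= size t & forall x c u, subseq ((x, c) :: u) t ->
        size u = r -> f (x :: map fst u) = c].
  (* Induction on the required length: after the head [x], the rest is built inside a sequence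
     homogeneous for [u => f (x :: u)]. *)
  elim: _.+1 => [|q [N1 IHq]].
    by exists 0 => T f s _; exists [::]; split=> //; apply: sub0seq.
  have [N2 HN2] := IHr N1; exists N2.+1 => T f [|x s] //= le_s.
  have [s1 [c [s1s le_s1 homs1]]] := HN2 T (fun u => f (x :: u)) s le_s.
  have [t [ts1 le_t Ht]] := IHq T f s1 le_s1.
  exists ((x, c) :: t); split=> //=.
    by rewrite eqxx (subseq_trans ts1).
  move=> y d u; case: eqP => [[-> ->] ut szu|_]; last exact: Ht.
  apply: homs1; last by rewrite size_map.
  exact: subseq_trans (map_subseq _ ut) ts1.
exists N => T f s /(HN T f) [t [ts lt_t Ht]].
have [||c le_c] := @pigeonhole_seq C m (map snd t).
- by rewrite size_map; apply: leq_trans lt_t.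
- by rewrite size_map ltnW.
exists (map fst [seq z <- t | z.2 == c]), c; split.
- exact: subseq_trans (map_subseq _ (filter_subseq _ _)) ts.
- by move: le_c; rewrite size_map size_filter count_map.
move=> u /subseq_map_inv [[|[x d] v] vt ->] //= [].
rewrite size_map => szv.
have : (x, d) \in [seq z <- t | z.2 == c].
  by apply: (mem_subseq vt); rewrite mem_head.
rewrite mem_filter => /andP[/= /eqP <- _].
exact: Ht (subseq_trans vt (filter_subseq _ _)) szv.
Qed.

(** * Rooted trees and top nodes of subtrees *)

Lemma acyclic_adj_path (G : sgraph) (x y : G) (p : seq G) :
  acyclic G -> adj x y -> path (@adj G) x p -> uniq (x :: p) ->
  last x p = y -> p = [:: y].
Proof.
move=> acG xy pp up lp.
have /acG : ucycle (@adj G) (x :: p).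
  by rewrite /ucycle up /= rcons_path pp lp adj_sym xy.
case: p lp {pp up} => [|z [|]] //= => [e|-> //].
by rewrite e adj_irrefl in xy.
Qed.

(** [rk] is the distance from [r], and [p] picks a neighbour closer to [r]. An edge that is not a
    parent edge would close a cycle with the parent paths of its ends. *)
Lemma tree_rooting (G : sgraph) : is_tree G ->
  exists (r : G) (p : G -> G) (rk : G -> nat),
    [/\ rk r = 0, p r = r, forall x, x != r -> rk (p x) < rk x &
      forall x y, adj x y -> y = p x \/ x = p y].
Proof.
case=> /card_gt0P [r _] conG acG; exists r.
pose P x n := [exists t : n.-tuple G, path (@adj G) r t && (last r t == x)].
have exP x : exists n, P x n.
  have /connectP [q qp ->] := conG r x.
  by exists (size q); apply/existsP; exists (in_tuple q); rewrite qp /=.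
pose rk x := ex_minn (exP x).
have exp x : exists y, if x == r then y = r else adj x y /\ rk y < rk x.
  case: (eqVneq x r) => [_|xr]; first by exists r.
  rewrite {2}/rk; case: ex_minnP => n /existsP[[/= t /eqP szt]].
  case/andP; case/lastP: t szt => [|q z].
    by move=> _ _ /= rx; rewrite eq_sym rx in xr.
  rewrite size_rcons rcons_path last_rcons => <- /andP[qp qz] /eqP zx.
  exists (last r q); split; first by rewrite adj_sym -zx.
  rewrite /rk; case: ex_minnP => j _; apply.
  by apply/existsP; exists (in_tuple q); rewrite qp /=.
have [p Hp'] := fin_all_exists exp.
have Hp x : x != r -> adj x (p x) /\ rk (p x) < rk x.
  by move=> /negbTE xr; have := Hp' x; rewrite xr.
exists p, rk; split=> [|||x y xy].
- apply/eqP; rewrite -leqn0 /rk; case: ex_minnP => j _; apply.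
  by apply/existsP; exists [tuple]; rewrite /=.
- by have := Hp' r; rewrite eqxx.
- by move=> x /Hp[].
case: (eqVneq y (p x)) => [|ypx]; first by left.
case: (eqVneq x (p y)) => [|xpy]; first by right.
exfalso.
(* Deleting the edge [x y] keeps all parent edges, hence connectivity to [r]. *)
pose e := [rel u v : G |
  adj u v && ~~ ((u == x) && (v == y) || (u == y) && (v == x))].
have e_sym : symmetric e.
  move=> u v; rewrite /= adj_sym; congr (_ && ~~ _).
  by rewrite orbC [(v == x) && _]andbC [(v == y) && _]andbC.
have to_r u : connect e u r.
  elim: {u}(rk u).+1 {-2}u (ltnSn (rk u)) => // n IHn u.
  rewrite ltnS => le_u; case: (eqVneq u r) => [->//|ur].
  have [upu lt_pu] := Hp u ur.
  apply: connect_trans (IHn _ (leq_trans lt_pu le_u)); apply: connect1.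
  rewrite /= upu /= negb_or !negb_and.
  apply/andP; split.
    by case: eqP => //= ->; rewrite eq_sym.
  by case: eqP => //= ->; rewrite eq_sym.
have /connectP [q0 q0p] : connect e x y.
  apply: connect_trans (to_r x) _.
  by rewrite (sym_connect_sym e_sym).
move=> lq; case/shortenP: q0p lq => q qp uq _ lq.
have qp' : path (@adj G) x q by apply: sub_path qp => u v /andP[].
have eq_q := acyclic_adj_path acG xy qp' uq (esym lq).
by move: qp; rewrite eq_q /= !eqxx /= !andbF.
Qed.


Lemma connect_closed_sub (T : finType) (e : rel T) (a : pred T) (x y : T) :
  (forall u v, e u v -> a u -> a v) -> connect e x y -> a x -> a y.
Proof.
move=> cl /connectP [q qp ->] {y}.
by elim: q x qp => //= z q IHq x /andP[/cl xz zq] /xz; apply: IHq.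
Qed.

Section TopNode.
Variables (G : sgraph) (r : G) (p : G -> G) (rk : G -> nat).
Hypothesis rk_r : rk r = 0.
Hypothesis p_r : p r = r.
Hypothesis rk_p : forall x, x != r -> rk (p x) < rk x.
Hypothesis adj_p : forall x y, adj x y -> y = p x \/ x = p y.

Lemma rk_fconnect x y : fconnect p x y -> x = y \/ rk y < rk x.
Proof.
move=> /iter_findex <-; elim: (findex _ _ _) => [|n IHn] /=; first by left.
case: (eqVneq (iter n p x) r) IHn => [-> |/rk_p lt_p]; first by rewrite p_r.
by case=> [e|lt_n]; right; [move: lt_p; rewrite -e | apply: ltn_trans lt_n].
Qed.

(* A connected set leaves the subtree below [x] only through the edge from
   [x] to its parent. *)
Lemma parent_in (A : {set G}) a x : connected (induced A) ->
  a \in A -> x \in A -> x != a -> rk a <= rk x ->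
  (p x \in A) && (rk (p x) < rk x).
Proof.
move=> conA aA xA xa le_a.
have xr : x != r.
  apply: contra_neq xa => xr; rewrite xr rk_r leqn0 in le_a *.
  apply/eqP; rewrite eq_sym; apply: contraTT le_a => /rk_p.
  by case: (rk a).
rewrite rk_p // andbT; apply: contraT => pxA.
(* If [p x] is outside [A], the nodes of [A] below [x] are closed under adjacency in [A], so [a] is
   below [x], against [rk a <= rk x]. *)
have : fconnect p a x.
  apply: (connect_closed_sub (a := fun u : induced A => fconnect p (val u) x) _
    (conA (exist _ x xA) (exist _ a aA))) => //= -[u uA] [v vA] /= uv ux.
  have /adj_p [v_pu|u_pv] := uv : adj u v; last first.
    by apply: connect_trans (fconnect1 p v) _; rewrite -u_pv.
  case/connectP: ux => -[_ /= xu|w q /= /andP[/eqP pu wq] ->].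
    by rewrite xu -v_pu vA in pxA.
  by rewrite v_pu pu; apply/connectP; exists q.
case/rk_fconnect => [e|]; first by rewrite e eqxx in xa.
by rewrite ltnNge le_a.
Qed.

(** Climb from [x] to [a] inside [A]. The climb never leaves [B]: that could happen only at [b],
    whose parent would be a node of [A] of smaller rank than [a]. *)
Lemma top_in (A B : {set G}) a b x :
  connected (induced A) -> connected (induced B) ->
  a \in A -> (forall y, y \in A -> rk a <= rk y) ->
  b \in B -> (forall y, y \in B -> rk b <= rk y) ->
  x \in A -> x \in B -> rk b <= rk a -> a \in B.
Proof.
move=> conA conB aA minA bB minB.
elim: {x}(rk x).+1 {-2}x (ltnSn (rk x)) => // n IHn x.
rewrite ltnS => le_x xA xB le_ba.
case: (eqVneq x a) => [<-//|xa].
have /andP[pA lt_p] := parent_in conA aA xA xa (minA _ xA).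
case: (eqVneq x b) => [xb|xb].
  by move: lt_p; rewrite xb ltnNge (leq_trans le_ba) // minA // -xb.
have /andP[pB _] := parent_in conB bB xB xb (minB _ xB).
exact: IHn (leq_trans lt_p le_x) pA pB le_ba.
Qed.

End TopNode.

(* [t v] is the topmost node of the subtree of [v] and [d v] its depth, so
   decreasing [d] is a perfect elimination ordering of the meeting graph. *)
Lemma td_top (G : sgraph) (S : tree_decomp G) :
  exists (t : G -> td_tree S) (d : G -> nat),
    forall u v (x : td_tree S), u \in td_bag x -> v \in td_bag x ->
      d v <= d u -> v \in td_bag (t u).
Proof.
have [r [p [rk [rk_r p_r rk_p adj_p]]]] := tree_rooting (td_treeP S).
have ext v : exists a : td_tree S, v \in td_bag a /\
    forall y : td_tree S, v \in td_bag y -> rk a <= rk y.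
  have [/card_gt0P [[x /= xv] _] _ _] := td_vertex S v.
  rewrite inE in xv.
  case: (@arg_minnP _ x (fun y => v \in td_bag y) rk xv) => a va mina.
  by exists a.
have [t Ht] := fin_all_exists ext.
exists t, (fun v => rk (t v)) => u v x ux vx le_vu.
have conn w : connected (induced [set x : td_tree S | w \in td_bag x]).
  by case: (td_vertex S w).
have [tu minu] := Ht u; have [tv minv] := Ht v.
have := top_in rk_r p_r rk_p adj_p (conn u) (conn v)
  (a := t u) (b := t v) (x := x).
rewrite !inE; apply=> // y; rewrite inE; [exact: minu|exact: minv].
Qed.

(** * The meeting graph: chordality and cliques *)

Definition meet (G : sgraph) (S : tree_decomp G) : rel G :=
  fun u v => [exists x : td_tree S, (u \in td_bag x) && (v \in td_bag x)].

Section Meet.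
Variables (G : sgraph) (S : tree_decomp G).

Lemma meet_sym : symmetric (meet S).
Proof. by move=> u v; apply: eq_existsb => x; rewrite andbC. Qed.

Lemma meet_refl : reflexive (meet S).
Proof.
move=> v; have [/card_gt0P [[x /= xv] _] _ _] := td_vertex S v.
by apply/existsP; exists x; rewrite inE in xv; rewrite xv.
Qed.

Lemma meet_adj u v : adj u v -> meet S u v.
Proof. by move/(td_edge S) => ?; apply/existsP. Qed.

(** Among the four vertices take one with the largest [rk], that is, with the deepest top node. Both
    its neighbours on the cycle lie in the bag of that node, hence meet. *)
Lemma meet_C4 a b c d : meet S a b -> meet S b c -> meet S c d -> meet S d a ->
  meet S a c || meet S b d.
Proof.
have [t [rk top]] := td_top S.
have top2 u v w : meet S u v -> meet S u w -> rk v <= rk u -> rk w <= rk u ->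
    meet S v w.
  move=> /existsP[x /andP[ux vx]] /existsP[y /andP[uy wy]] lv lw.
  by apply/existsP; exists (t u); rewrite (top u v x) // (top u w y).
move=> ab bc cd da.
have ba : meet S b a by rewrite meet_sym.
have cb : meet S c b by rewrite meet_sym.
have dc : meet S d c by rewrite meet_sym.
have ad : meet S a d by rewrite meet_sym.
have [l1|/ltnW l1] := leqP (rk a) (rk c);
  have [l2|/ltnW l2] := leqP (rk b) (rk d).
- have [l|/ltnW l] := leqP (rk c) (rk d).
  + by rewrite (top2 d a c) // (leq_trans l1).
  + by rewrite (top2 c b d) ?orbT // (leq_trans l2).
- have [l|/ltnW l] := leqP (rk c) (rk b).
  + by rewrite (top2 b a c) // (leq_trans l1).
  + by rewrite (top2 c b d) ?orbT // (leq_trans l2).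
- have [l|/ltnW l] := leqP (rk a) (rk d).
  + by rewrite (top2 d a c) // (leq_trans l1).
  + by rewrite (top2 a b d) ?orbT // (leq_trans l2).
- have [l|/ltnW l] := leqP (rk a) (rk b).
  + by rewrite (top2 b a c) // (leq_trans l1).
  + by rewrite (top2 a b d) ?orbT // (leq_trans l2).
Qed.

(** The bag at the deepest top node of a member of [A] contains every other member. *)
Lemma meet_helly (A : {set G}) : A != set0 ->
  {in A &, forall u v, meet S u v} ->
  exists x : td_tree S, A \subset td_bag x.
Proof.
have [t [rk top]] := td_top S.
case/set0Pn=> a0 a0A cl; case: (@arg_maxnP _ a0 (mem A) rk a0A) => a aA maxa.
exists (t a); apply/subsetP => v vA.
have /existsP[x /andP[ax vx]] := cl a v aA vA.
by apply: (top a v x) => //; apply: maxa.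
Qed.

End Meet.

Lemma orthogonal_clique (G : sgraph) (k : nat) (S T : tree_decomp G)
    (A : {set G}) :
  orthogonal k S T -> {in A &, forall u v, meet S u v && meet T u v} ->
  #|A| <= k.
Proof.
move=> oST cl; case: (eqVneq A set0) => [->|A0]; first by rewrite cards0.
have [|x Ax] := @meet_helly _ S A A0.
  by move=> u v uA vA; case/andP: (cl u v uA vA).
have [|y Ay] := @meet_helly _ T A A0.
  by move=> u v uA vA; case/andP: (cl u v uA vA).
by apply: leq_trans (oST x y); rewrite subset_leq_card // subsetI Ax.
Qed.

Lemma orthogonal_sequence (G : sgraph) (k : nat) (S T : tree_decomp G)
    (w : nat -> G) :
  orthogonal k S T -> (forall i j, i < j <= k -> w i != w j) ->
  (forall i j, i < j <= k -> meet S (w i) (w j) && meet T (w i) (w j)) -> False.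
Proof.
move=> oST winj cl.
have inj : injective (fun i : 'I_k.+1 => w i).
  move=> i j /eqP; apply: contraTeq => ij; rewrite -val_eqE /= in ij.
  have i_k : i <= k := ltn_ord i.
  have j_k : j <= k := ltn_ord j.
  case: (ltngtP i j) ij => // lt_ij _; last rewrite eq_sym.
    by rewrite winj ?lt_ij.
  by rewrite winj ?lt_ij.
have := @orthogonal_clique G k S T [set w (val i) | i : 'I_k.+1] oST.
rewrite card_imset // card_ord ltnn => H; apply: notF; apply: H => u v.
case/imsetP=> i _ -> /imsetP[j _ ->].
have i_k : i <= k := ltn_ord i.
have j_k : j <= k := ltn_ord j.
case: (ltngtP i j) => [ij|ji|/val_inj ->]; last by rewrite !meet_refl.
  by rewrite cl ?ij.
by rewrite meet_sym [meet T _ _]meet_sym cl ?ji.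
Qed.

(** * Homogeneous families of pairs *)

Section Homogeneous.
Variables (n m : nat) (x : nat -> 'I_n) (v : nat -> nat -> shift_graph n).
Hypothesis val_v : forall i j, i < j < m -> val (v i j) = (x i, x j).

Lemma adj_v i j l : i < j < l -> l < m -> adj (v i j) (v j l).
Proof.
move=> /andP[ij jl] lm; apply/orP; left.
by rewrite !val_v ?ij ?jl ?lm ?(ltn_trans jl) //=.
Qed.

Variables (S : tree_decomp (shift_graph n)) (L R : bool).
Hypothesis HL : forall i j l, i < j < l -> l < m -> meet S (v i j) (v i l) = L.
Hypothesis HR : forall i j l, i < j < l -> l < m -> meet S (v i l) (v j l) = R.

Lemma meet_shift i j l : i < j < l -> l < m -> meet S (v i j) (v j l).
Proof. by move=> ijl lm; rewrite meet_adj ?adj_v. Qed.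

Lemma left_or_right : 4 < m -> L || R.
Proof.
move=> m4; have m3 := ltnW m4; have m2 := ltnW m3.
(* The chords of this 4-cycle are an R pair, [(0,2)] and [(1,2)], and an L pair, [(2,3)] and
   [(2,4)]. *)
have := @meet_C4 _ S (v 0 2) (v 2 3) (v 1 2) (v 2 4).
rewrite (@HR 0 1) // (@HL 2 3) // orbC.
by apply; rewrite ?meet_shift // meet_sym meet_shift.
Qed.

Lemma meet_disjoint a b c d : L != R -> 4 < m -> a < b < c -> c < d < m ->
  meet S (v a b) (v c d).
Proof.
move=> LR m4 /andP[ab bc] /andP[cd dm].
have cm := ltn_trans cd dm.
have abc : a < b < c by rewrite ab.
have bcd : b < c < d by rewrite bc.
have abd : a < b < d by rewrite ab (ltn_trans bc).
have acd : a < c < d by rewrite (ltn_trans ab).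
have := left_or_right m4; case: L R HL HR LR => -[] // hL hR _ _.
  (* With L only: [(a,c)] and [(a,b)] meet by L, and the chord from [(b,c)] to [(a,c)] would be
     R. *)
  have := @meet_C4 _ S (v a b) (v b c) (v c d) (v a c).
  rewrite [meet S (v b c) (v a c)]meet_sym hR // orbF; apply.
  - exact: meet_shift.
  - exact: meet_shift.
  - by rewrite meet_sym meet_shift.
  - by rewrite meet_sym hL.
(* With R only: [(c,d)] and [(b,d)] meet by R, and the chord from [(b,c)] to [(b,d)] would be L. *)
have := @meet_C4 _ S (v a b) (v b c) (v c d) (v b d).
rewrite hL // orbF; apply.
- exact: meet_shift.
- exact: meet_shift.
- by rewrite meet_sym hR.
- by rewrite meet_sym meet_shift.
Qed.

End Homogeneous.

(** * Ramsey's theorem applied to the shift graph *)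

Theorem theorem39 (k : nat) (k_gt0 : 0 < k) :
  exists n : nat,
    ~ exists S T : tree_decomp (shift_graph n), orthogonal k S T.
Proof.
(* The disjoint pairs use indices up to [k.*2.+1], and [left_or_right] needs [4 < m]. *)
pose m := k.*2 + 5.
have [n ram] := ramsey (bool * bool * (bool * bool))%type 3 m.
exists n.+2 => -[S [T oST]].
(* With [n.+2] points a vertex exists; it is the default value of [pr] on pairs that are not
   increasing. *)
pose v0 : shift_graph n.+2 :=
  exist (fun q : 'I_n.+2 * 'I_n.+2 => q.1 < q.2) (ord0, ord_max) isT.
pose pr i j : shift_graph n.+2 := insubd v0 (i, j).
(* The colour of a triple records L and R for [S], then for [T]. *)
pose f (u : seq 'I_n.+2) := if u is [:: a; b; c] then
   (meet S (pr a b) (pr a c), meet S (pr a c) (pr b c),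
   (meet T (pr a b) (pr a c), meet T (pr a c) (pr b c)))
  else (true, true, (true, true)).
have [|t [[[LS RS] [LT RT]] [sub_t m_t hom]]] := ram _ f (enum 'I_n.+2).
  by rewrite size_enum_ord ltnW.
pose x i := nth ord0 t i.
have x_mono i j : i < j < m -> x i < x j.
  case/andP=> ij jm; have j_t := leq_trans jm m_t.
  have : sorted ltn (map val t).
    apply: subseq_sorted (map_subseq _ sub_t) _; first exact: ltn_trans.
    by rewrite val_enum_ord iota_ltn_sorted.
  move/(sorted_ltn_nth ltn_trans 0)/(_ i j).
  rewrite !inE size_map (ltn_trans ij) // j_t => /(_ isT isT ij).
  by rewrite !(nth_map ord0) // (ltn_trans ij).
pose v i j := pr (x i) (x j).
have val_v i j : i < j < m -> val (v i j) = (x i, x j).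
  by move=> ijm; rewrite /v /pr insubdK // unfold_in /= x_mono.
have hom3 i j l : i < j < l -> l < m ->
    f [:: x i; x j; x l] = (LS, RS, (LT, RT)).
  case/andP=> ij jl lm; apply: hom => //.
  (* The triple is a subsequence of [t] because [[:: i; j; l]] is one of the list of all indices of
     [t]. *)
  have -> : [:: x i; x j; x l] = [seq nth ord0 t a | a <- [:: i; j; l]] by [].
  rewrite -{2}[t](mkseq_nth ord0) map_subseq //.
  apply/(subseq_uniqP (iota_uniq _ _)); apply: (irr_sorted_eq ltn_trans ltnn).
  - by rewrite /= ij jl.
  - by rewrite sorted_filter ?iota_ltn_sorted //; apply: ltn_trans.
  move=> a; rewrite mem_filter mem_iota.
  have l_t := leq_trans lm m_t; have j_t := ltn_trans jl l_t.
  case: (boolP (a \in _)) => //; rewrite !inE.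
  by case/or3P=> /eqP->; rewrite ?l_t ?j_t ?(ltn_trans ij).
have HLS i j l : i < j < l -> l < m -> meet S (v i j) (v i l) = LS.
  by move=> ijl lm; case: (hom3 i j l ijl lm).
have HRS i j l : i < j < l -> l < m -> meet S (v i l) (v j l) = RS.
  by move=> ijl lm; case: (hom3 i j l ijl lm).
have HLT i j l : i < j < l -> l < m -> meet T (v i j) (v i l) = LT.
  by move=> ijl lm; case: (hom3 i j l ijl lm).
have HRT i j l : i < j < l -> l < m -> meet T (v i l) (v j l) = RT.
  by move=> ijl lm; case: (hom3 i j l ijl lm).
have v_neq i j a b : i < j < m -> a < b < m ->
    x i != x a \/ x j != x b -> v i j != v a b.
  move=> ijm abm ne; apply/eqP => /(congr1 val); rewrite !val_v // => -[ia jb].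
  by case: ne; rewrite ?ia ?jb eqxx.
have x_neq i j : i < j < m -> x i != x j.
  by move=> /x_mono; rewrite ltn_neqAle => /andP[].
have m4 : 4 < m by lia.
have LRS := left_or_right val_v HLS HRS m4.
have LRT := left_or_right val_v HLT HRT m4.
have [/andP[eLS eLT]|nL] := boolP (LS && LT).
  (* The star of pairs with least element [x 0]. *)
  apply: (@orthogonal_sequence _ k S T (fun i => v 0 i.+1)) => //= i j ijk.
    by apply: v_neq; [| |right; apply: x_neq]; lia.
  by rewrite HLS ?HLT ?eLS //; lia.
have [/andP[eRS eRT]|nR] := boolP (RS && RT).
  (* The star of pairs with greatest element [x m.-1]. *)
  apply: (@orthogonal_sequence _ k S T (fun i => v i m.-1)) => //= i j ijk.
    by apply: v_neq; [| |left; apply: x_neq]; lia.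
  by rewrite HRS ?HRT ?eRS //; lia.
have [neS neT] : LS != RS /\ LT != RT.
  by clear -LRS LRT nL nR; case: LS RS LT RT LRS LRT nL nR => [] [] [] [].
apply: (@orthogonal_sequence _ k S T (fun i => v i.*2 i.*2.+1)) => //= i j ijk.
  by apply: v_neq; [| |left; apply: x_neq]; lia.
by rewrite (meet_disjoint val_v HLS HRS) ?(meet_disjoint val_v HLT HRT) //; lia.
Qed.
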